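(* Let $G=(V,E)$ be a finite, strongly connected directed graph and let $(X_n)_{n\in\mathbb{N}}$ be a locally Markov walk on $G$ whose local chains have strictly positive transition probabilities, i.e. $\mathsf{m}_x(y,z)>0$ for all $x\in V$ and $y,z\in N_x$. Let $q_x$ be the stationary distribution of the local chain at $x$, extended by $0$ to $V\setminus N_x$, let $Q=(q_x(y))_{x,y\in V}$, and let $\pi$ be the unique probability distribution on $V$ with $\pi Q=\pi$. Then for every $f:V\to\mathbb{R}$, almost surely, $$\lim_{t\to\infty}\frac1t\sum_{n=0}^{t}f(X_n)=\sum_{x\in V}f(x)\pi(x).$$ In particular, for every $x\in V$ the proportion of visits to $x$ by $(X_n)_{n\in\mathbb{N}}$ until time $t$ converges almost surely to $\pi(x)$ as $t\to\infty$.
   Context: Graph: $G=(V,E)$ is a finite directed graph without loops or multiple edges, strongly connected, $|V|\ge 2$; $N_x=\{y\in V:(x,y)\in E\}$. Local chains: for every $x\in V$ a stochastic matrix $\mathsf{M}_x=(\mathsf{m}_x(y,z))_{y,z\in N_x}$ is given, the transition matrix of the local chain at $x$. Configurations: a configuration is a map $\rho:V\to V$ with $\rho(x)\in N_x$ for all $x$. Locally Markov walk: a locally Markov walk with these local chains is a $V$-valued process $(X_n)_{n\in\mathbb{N}}$ such that, for an initial configuration $\rho_0$ (fixed or random) and with $\rho_n(x)$ denoting the vertex to which the walk moved at its most recent exit from $x$ before time $n$ ($\rho_n(x)=\rho_0(x)$ if there was none), the process $(X_n,\rho_n)_{n\in\mathbb{N}}$ (the total chain) is a Markov chain with one-step transition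 probabilities $$p((x,\rho),(y,\eta))=\begin{cases}\mathsf{m}_x(\rho(x),y),&\text{if }\eta(v)=\rho(v)\text{ for all }v\ne x\text{ and }\eta(x)=y,\\0,&\text{otherwise.}\end{cases}$$ Thus at each vertex $x$ the successive exits from $x$ form a Markov chain with transition matrix $\mathsf{M}_x$. *)

(* Defs.v *)
From HB Require Import structures.
From mathcomp Require Import all_boot all_order all_algebra.
From mathcomp Require Import all_classical all_reals all_analysis.
Set Implicit Arguments.
Unset Strict Implicit.
Unset Printing Implicit Defensive.
Import Order.TTheory GRing.Theory Num.Theory.
Import numFieldNormedType.Exports.
Local Open Scope classical_set_scope.
Local Open Scope ring_scope.

Definition strongly_connected (V : finType) (e : rel V) : Prop :=
  forall x y : V, connect e x y.

(* The out-neighbourhood N_x as a finite type; [val] maps it into [V]. *)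
Definition nbr (V : finType) (e : rel V) (x : V) : finType := {y : V | e x y}.

Definition config (V : finType) (e : rel V) : finType :=
  {dffun forall x : V, nbr e x}.

Definition stochastic (R : realType) (T : finType) (A : T -> T -> R) : Prop :=
  (forall i j, 0 <= A i j) /\ (forall i, \sum_j A i j = 1).

Definition distribution_on (R : realType) (T : finType) (mu : T -> R) : Prop :=
  (forall i, 0 <= mu i) /\ \sum_i mu i = 1.

Definition stationary_distribution (R : realType) (T : finType)
    (A : T -> T -> R) (mu : T -> R) : Prop :=
  distribution_on mu /\ (forall j, \sum_i mu i * A i j = mu j).

Definition extend_by_zero (R : realType) (V : finType) (e : rel V)
    (q : forall x : V, nbr e x -> R) (x y : V) : R :=
  if insub y is Some z then q x z else 0.

Definition cond_prob (R : realType) (d : measure_display)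
    (Omega : measurableType d) (P : probability Omega R) (A B : set Omega) : R :=
  fine (P (A `&` B)) / fine (P B).

(* Time-homogeneous Markov chain on a finite state space, with arbitrary
   initial law. *)
Definition markov_chain (R : realType) (d : measure_display)
    (Omega : measurableType d) (P : probability Omega R) (S : finType)
    (p : S -> S -> R) (Z : nat -> Omega -> S) : Prop :=
  (forall n s, measurable [set w | Z n w = s]) /\
  (forall (n : nat) (s : nat -> S) (t : S),
    let past := [set w | forall k, (k <= n)%N -> Z k w = s k] in
    P past != 0%E -> cond_prob P [set w | Z n.+1 w = t] past = p (s n) t).

Definition total_transition (R : realType) (V : finType) (e : rel V)
    (m : forall x : V, nbr e x -> nbr e x -> R)
    (s t : (V * config e)%type) : R :=
  let: (x, rho) := s in
  let: (y, eta) := t in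
  if [forall v, (v != x) ==> (eta v == rho v)] && (val (eta x) == y)
  then m x (rho x) (eta x) else 0.

(* An exit "before time n" is a step [k -> k.+1] with [k < n]; in particular
   the step from time [n.-1] to time [n] counts. *)
Definition records_last_exits (V : finType) (e : rel V)
    (X : nat -> V) (rho : nat -> config e) : Prop :=
  forall (n : nat) (x : V),
    (forall k, (k < n)%N -> X k = x ->
       (forall j, (k < j < n)%N -> X j <> x) -> val (rho n x) = X k.+1) /\
    ((forall k, (k < n)%N -> X k <> x) -> rho n x = rho 0%N x).

Definition locally_markov_walk (R : realType) (d : measure_display)
    (Omega : measurableType d) (P : probability Omega R)
    (V : finType) (e : rel V) (m : forall x : V, nbr e x -> nbr e x -> R)
    (X : nat -> Omega -> V) : Prop :=
  exists rho : nat -> Omega -> config e,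
    (forall w, records_last_exits (X ^~ w) (rho ^~ w)) /\
    markov_chain P (total_transition m) (fun n w => (X n w, rho n w)).

(* Main.v *)
(* The function f(x) - pi(f) on the total chain (x, rho) has an explicit
   solution g of the Poisson equation g - p g = f - pi(f): take phi solving
   (I - Q) phi = f - pi(f), take u_x solving (I - M_x) u_x = M_x phi - q_x(phi)
   on N_x, and put g(x, rho) = phi(x) + \sum_v u_v(rho(v)). Hence no ergodic
   theory of the (possibly reducible) total chain is needed: the sums of
   f(X_n) - pi(f) are, up to the bounded term g(Z_0) - g(Z_n), a martingale with
   bounded increments. Its fourth moment is O(n^2), so Markov's inequality and
   the Borel-Cantelli lemma give the strong law. *)

Require Import Defs.
From HB Require Import structures.
From mathcomp Require Import all_boot all_order all_algebra.
From mathcomp Require Import all_classical all_reals all_analysis.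
From mathcomp Require Import ring lra.
Import Order.TTheory GRing.Theory Num.Theory.
Import numFieldNormedType.Exports.
Local Open Scope classical_set_scope.
Local Open Scope ring_scope.

(** * Poisson equation for a finite chain *)

Lemma injective_system_solvable (F : fieldType) (T : finType) (B : T -> T -> F) :
  (forall v : T -> F,
     (forall i, \sum_j B i j * v j = 0) -> forall j, v j = 0) ->
  forall h : T -> F, exists u : T -> F, forall i, \sum_j B i j * u j = h i.
Proof.
move=> B_inj h.
(* [M] is the transpose of [B], indexed by ordinals: row vectors multiplied by it then produce the
   sums over the second index of [B]. *)
pose M := \matrix_(i, j) B (enum_val j) (enum_val i) : 'M[F]_#|T|.
have mulME (v : 'rV[F]_#|T|) j :
    (v *m M) 0 j = \sum_i B (enum_val j) i * v 0 (enum_rank i).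
  rewrite mxE [RHS](reindex (@enum_val T T)); last exact/onW_bij/enum_val_bij.
  by apply: eq_bigr => i _; rewrite mxE enum_valK mulrC.
have Munit : M \in unitmx.
  rewrite unitmxE unitfE; apply/det0P => -[v v_neq0 vM0].
  case/eqP: v_neq0; apply/rowP => j.
  rewrite [in RHS]mxE -[j]enum_valK; apply: (B_inj (v 0 \o enum_rank)) => i.
  by rewrite -[i]enum_rankK -mulME vM0 mxE.
exists (fun i => ((\row_j h (enum_val j)) *m invmx M) 0 (enum_rank i)) => i.
by rewrite -{1}[i]enum_rankK -mulME mulmxKV// mxE enum_rankK.
Qed.

(* Maximum principle: the set where a harmonic function attains its maximum
   is closed under the transitions of positive probability. *)
Lemma harmonic_constant (R : realType) (T : finType) (A : T -> T -> R)
    (v : T -> R) :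
  stochastic A -> strongly_connected (fun i j => 0 < A i j) ->
  (forall i, \sum_j A i j * v j = v i) -> forall i j, v i = v j.
Proof.
move=> [A_ge0 A_sum1] A_conn v_harm i0 j0.
pose k := [arg max_(k > i0) v k]%O.
have v_le j : v j <= v k.
  by rewrite /k; case: Order.TotalTheory.arg_maxP => // i _; apply.
suff v_eq j : v j = v k by rewrite !v_eq.
have /connectP [p] := A_conn k j.
have : v k = v k by [].
elim: p {1 3 4}k => [|y p IHp] x vx /=; first by move=> _ ->.
move=> /andP[Axy xp] jE; apply: (IHp y) => //.
have /eqP : \sum_z A x z * (v k - v z) = 0.
  under eq_bigr do rewrite mulrBr.
  by rewrite sumrB -mulr_suml A_sum1 mul1r v_harm vx subrr.
rewrite psumr_eq0 => [/allP /(_ y)|z _]; last by rewrite mulr_ge0// subr_ge0.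
rewrite mem_index_enum => /(_ isT) /=.
by rewrite mulf_eq0 gt_eqF//= subr_eq0 => /eqP.
Qed.

(* The system [(I - A + 1 mu^T) u = h - mu(h)] is invertible, and applying [mu]
   to it shows that its solution satisfies [mu(u) = 0]. *)
Lemma poisson_equation (R : realType) (T : finType) (A : T -> T -> R)
    (mu : T -> R) (h : T -> R) :
  stochastic A -> strongly_connected (fun i j => 0 < A i j) ->
  stationary_distribution A mu ->
  exists u : T -> R, forall i,
    u i - \sum_j A i j * u j = h i - \sum_j mu j * h j.
Proof.
move=> A_sto A_conn [[mu_ge0 mu_sum1] mu_stat].
pose B i j : R := (i == j)%:R - A i j + mu j.
have BE v i : \sum_j B i j * v j
    = v i - \sum_j A i j * v j + \sum_j mu j * v j.
  rewrite /B; under eq_bigr do rewrite mulrDl mulrBl.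
  rewrite big_split/= sumrB; congr (_ - _ + _).
  rewrite (bigD1 i)//= eqxx mul1r big1 ?addr0// => j.
  by rewrite eq_sym => /negbTE ->; rewrite mul0r.
have mu_cst c : \sum_j mu j * c = c by rewrite -mulr_suml mu_sum1 mul1r.
have muB v : \sum_i mu i * \sum_j B i j * v j = \sum_j mu j * v j.
  under eq_bigr do rewrite BE mulrDr mulrBr.
  rewrite big_split/= mu_cst sumrB.
  under [X in _ - X + _]eq_bigr do rewrite mulr_sumr.
  rewrite exchange_big/=.
  under [X in _ - X + _]eq_bigr do under eq_bigr do rewrite mulrA.
  under [X in _ - X + _]eq_bigr do rewrite -mulr_suml mu_stat.
  by rewrite subrr add0r.
have [v Bv0|u uE] :=
    injective_system_solvable _ _ B _ (fun i => h i - \sum_j mu j * h j).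
  (* A kernel vector has mean zero under [mu], hence is harmonic for [A], hence constant; the
     constant equals its mean, so it is 0. *)
  have muv0 : \sum_j mu j * v j = 0.
    by rewrite -muB big1// => i _; rewrite Bv0 mulr0.
  have v_cst : forall i j, v i = v j.
    apply: harmonic_constant A_sto A_conn _ => i.
    by have := Bv0 i; rewrite BE muv0 addr0 => /eqP; rewrite subr_eq0 => /eqP.
  move=> j; rewrite -muv0; under eq_bigr do rewrite (v_cst _ j).
  by rewrite mu_cst.
have muu0 : \sum_j mu j * u j = 0.
  rewrite -muB; under eq_bigr do rewrite uE mulrBr.
  by rewrite sumrB mu_cst subrr.
by exists u => i; rewrite -uE BE muu0 addr0.
Qed.

(** * The matrix Q and the total chain *)

Lemma extend_by_zero_sum (R : realType) (V : finType) (e : rel V)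
    (q : forall x : V, nbr e x -> R) (phi : V -> R) (x : V) :
  \sum_y extend_by_zero q x y * phi y = \sum_z q x z * phi (val z).
Proof.
rewrite (bigID (e x))/= addrC big1 ?add0r => [|y /negPf exy]; last first.
  by rewrite /extend_by_zero insubF ?mul0r.
rewrite (reindex_omap (val : nbr e x -> V) insub) => [|y exy]; last first.
  by rewrite insubT.
apply: eq_big => z; first by rewrite valK eqxx (valP z).
by rewrite /extend_by_zero valK.
Qed.

Lemma extend_by_zero_stochastic (R : realType) (V : finType) (e : rel V)
    (q : forall x : V, nbr e x -> R) :
  (forall x, distribution_on (q x)) -> stochastic (extend_by_zero q).
Proof.
move=> q_dist; split=> [x y|x].
  by rewrite /extend_by_zero; case: insubP => // z _ _; have [+ _] := q_dist x.
under eq_bigr do rewrite -[extend_by_zero _ _ _]mulr1.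
rewrite (extend_by_zero_sum _ _ _ _ (fun=> 1)); under eq_bigr do rewrite mulr1.
by have [] := q_dist x.
Qed.

(** If [mu j] were 0, stationarity would make every nonnegative term [mu i * A i j] vanish, so [mu]
    would be zero everywhere, against total mass 1. This gives each edge a positive weight in Q. *)
Lemma stationary_positive (R : realType) (T : finType) (A : T -> T -> R)
    (mu : T -> R) :
  (forall i j, 0 < A i j) -> stationary_distribution A mu ->
  forall j, 0 < mu j.
Proof.
move=> A_gt0 [[mu_ge0 mu_sum1] mu_stat] j.
have muA_ge0 i : true -> 0 <= mu i * A i j by rewrite mulr_ge0// ltW.
rewrite lt_neqAle mu_ge0 andbT eq_sym -mu_stat psumr_eq0//.
apply/negP => /allP mu0; have /eqP := oner_eq0 R; apply.
rewrite -mu_sum1 big1// => i _; apply/eqP.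
by have := mu0 i (mem_index_enum i); rewrite mulf_eq0 [A i j == 0]gt_eqF ?orbF.
Qed.

Definition set_exit (V : finType) (e : rel V) (rho : config e) (x : V)
  (z : nbr e x) : config e := finfun (@eqtype.dfwith V (nbr e) rho x z).

(** The only possible successors of [(x, rho)] are the states obtained by redirecting [rho] at [x]
    to some [z] and moving there, and they are in bijection with the out-neighbours [z] of [x]. *)
Lemma total_transition_sum (R : realType) (V : finType) (e : rel V)
    (m : forall x : V, nbr e x -> nbr e x -> R) (x : V) (rho : config e)
    (h : V * config e -> R) :
  \sum_t total_transition m (x, rho) t * h t =
  \sum_z m x (rho x) z * h (val z, set_exit _ _ rho x z).
Proof.
pose C (t : V * config e) :=
  [forall v, (v != x) ==> (t.2 v == rho v)] && (val (t.2 x) == t.1).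
have pE t : total_transition m (x, rho) t = if C t then m x (rho x) (t.2 x) else 0.
  by case: t.
under eq_bigr do rewrite pE.
rewrite (bigID C)/= addrC big1 ?add0r => [|t /negPf ->]; last by rewrite mul0r.
have set_exitK z : set_exit _ _ rho x z x = z by rewrite ffunE eqtype.dfwith_in.
rewrite (reindex_onto (fun z => (val z, set_exit _ _ rho x z)) (fun t => t.2 x))/=;
    last first.
  move=> [y eta] /andP[/= /forallP eta_rho /eqP <-]; congr (_, _).
  apply/ffunP => v; rewrite ffunE; have [<-|vx] := eqVneq x v.
    by rewrite eqtype.dfwith_in.
  rewrite eqtype.dfwith_out//; apply/esym/eqP.
  by have := eta_rho v; rewrite eq_sym vx.
have Cset z : C (val z, set_exit _ _ rho x z).
  rewrite /C/= set_exitK eqxx andbT; apply/forallP => v; apply/implyP => vx.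
  by rewrite ffunE eqtype.dfwith_out// eq_sym.
apply: eq_big => z; first by rewrite Cset set_exitK eqxx.
by rewrite Cset set_exitK.
Qed.

Lemma total_transition_stochastic (R : realType) (V : finType) (e : rel V)
    (m : forall x : V, nbr e x -> nbr e x -> R) :
  (forall x, stochastic (m x)) -> stochastic (total_transition m).
Proof.
move=> m_sto; split=> [[x rho] [y eta]|[x rho]].
  by rewrite /=; case: ifP => // _; have [+ _] := m_sto x.
under eq_bigr do rewrite -[total_transition _ _ _]mulr1.
rewrite (total_transition_sum _ _ _ _ _ _ (fun=> 1)).
under eq_bigr do rewrite mulr1.
by have [_] := m_sto x.
Qed.

(* A step out of [x] only changes the summand [u x (rho x)] of
   [g (x, rho) = phi x + \sum_v u v (rho v)]. *)
Lemma total_poisson_equation (R : realType) (V : finType) (e : rel V)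
    (m : forall x : V, nbr e x -> nbr e x -> R)
    (q : forall x : V, nbr e x -> R) (pi : V -> R) (f : V -> R) :
  strongly_connected e ->
  (forall x, stochastic (m x)) -> (forall x y z, 0 < m x y z) ->
  (forall x, stationary_distribution (m x) (q x)) ->
  stationary_distribution (extend_by_zero q) pi ->
  exists g : V * config e -> R, forall s,
    g s - \sum_t total_transition m s t * g t = f s.1 - \sum_x pi x * f x.
Proof.
move=> e_conn m_sto m_gt0 q_stat pi_stat.
have q_dist x : distribution_on (q x) by have [] := q_stat x.
have Q_conn : strongly_connected (fun x y => 0 < extend_by_zero q x y).
  move=> x y; apply: connect_sub (e_conn x y) => {x y} x y exy.
  apply: connect1; rewrite /extend_by_zero insubT.
  exact: stationary_positive (m_gt0 x) (q_stat x) _.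
have [phi phiE] := poisson_equation _ _ _ _ f
  (extend_by_zero_stochastic _ _ _ _ q_dist) Q_conn pi_stat.
pose mphi x (y : nbr e x) := \sum_z m x y z * phi (val z).
have m_conn x : strongly_connected (fun y z => 0 < m x y z).
  by move=> y z; exact: connect1.
(* Stationarity of [q x] gives q_x(M_x phi) = q_x(phi) = (Q phi)(x), so the centering constant in
   the local Poisson equation is exactly the term subtracted from [phi x] in the equation for Q. *)
have q_mphi x : \sum_y q x y * mphi x y = \sum_z q x z * phi (val z).
  under eq_bigr do rewrite mulr_sumr.
  rewrite exchange_big; apply: eq_bigr => z _.
  under eq_bigr do rewrite mulrA.
  by rewrite -mulr_suml; have [_ ->] := q_stat x.
pose u x := projT1 (cid (poisson_equation _ _ _ _ (mphi x)
  (m_sto x) (m_conn x) (q_stat x))).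
have uE x y : u x y - \sum_z m x y z * u x z
    = mphi x y - \sum_z q x z * phi (val z).
  by rewrite -q_mphi /u; case: cid.
exists (fun s : V * config e => phi s.1 + \sum_v u v (s.2 v)) => -[x rho].
rewrite total_transition_sum /= -phiE extend_by_zero_sum.
pose rest := \sum_(v | v != x) u v (rho v).
have uD z : \sum_v u v (set_exit _ _ rho x z v) = u x z + rest.
  rewrite (bigD1 x)//= ffunE eqtype.dfwith_in; congr (_ + _).
  by apply: eq_bigr => v vx; rewrite ffunE eqtype.dfwith_out// eq_sym.
under [X in _ - X]eq_bigr do rewrite uD !mulrDr.
rewrite !big_split/= -(mulr_suml _ _ _ rest).
have [_ ->] := m_sto x; rewrite mul1r (bigD1 x)//= -/rest.
by have := uE x (rho x); rewrite -/(mphi x (rho x)); lra.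
Qed.

(** * Law of finite paths of a Markov chain *)

(* Most recent state first, so that a step of the chain is a [cons]. *)
Definition history (S : Type) (z : nat -> S) (n : nat) : n.+1.-tuple S :=
  [tuple z (n - i)%N | i < n.+1].

Lemma historyS (S : Type) (z : nat -> S) (n : nat) :
  history S z n.+1 = cons_tuple (z n.+1) (history S z n).
Proof.
apply: eq_from_tnth => i; rewrite tnth_mktuple.
have [->|[j ->]] : i = ord0 \/ exists j, i = lift ord0 j.
- by case: (unliftP ord0 i) => [j|] ->; [right; exists j|left].
- by rewrite subn0.
- by rewrite tnthS tnth_mktuple.
Qed.

Lemma tuple_recl_sum (R : nmodType) (S : finType) (n : nat)
    (F : n.+1.-tuple S -> R) :
  \sum_u F u = \sum_(v : n.-tuple S) \sum_t F (cons_tuple t v).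
Proof.
rewrite pair_big/= (reindex (fun vt => cons_tuple vt.2 vt.1))//=.
exists (fun u : n.+1.-tuple S => ([tuple of behead u], thead u)) => [[v t]|u] _.
  by congr (_, _); exact: val_inj.
by rewrite [RHS]tuple_eta; apply: val_inj.
Qed.

Lemma probability_fibers (R : realType) (d : measure_display)
    (Omega : measurableType d) (P : probability Omega R) (I : finType)
    (H : Omega -> I) (C : pred I) :
  (forall i, measurable [set w | H w = i]) ->
  P [set w | C (H w)] = (\sum_(i | C i) P [set w | H w = i])%E.
Proof.
move=> mH.
have -> : [set w | C (H w)] = \bigcup_(i in [set` enum C]) [set w | H w = i].
  apply/seteqP; split=> [w CHw|w [i]] /=.
    by exists (H w) => //=; rewrite mem_enum.
  by rewrite mem_enum => Ci ->.
rewrite measure_fin_bigcup//.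
- by rewrite -fsbig_seq ?enum_uniq// big_enum.
- by move=> i j _ _ [w [/= -> ->]].
Qed.

Section PathLaw.
Context {R : realType} {d : measure_display} {Omega : measurableType d}.
Context {P : probability Omega R} {S : finType} {p : S -> S -> R}.
Context {Z : nat -> Omega -> S}.
Hypothesis Z_markov : markov_chain P p Z.

Let hist n w := history S (Z ^~ w) n.

Lemma measurable_history n u : measurable [set w | hist n w = u].
Proof.
have [mZ _] := Z_markov.
have -> : [set w | hist n w = u] =
    \bigcap_(i : 'I_n.+1) [set w | Z (n - i)%N w = tnth u i].
  apply/seteqP; split=> [w <- i _|w hw]; first by rewrite tnth_mktuple.
  by apply: eq_from_tnth => i; rewrite tnth_mktuple; exact: hw.
by apply: fin_bigcap_measurable => // i _; exact: mZ.
Qed.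

(** Moments of functions of the first [n.+1] states become finite real sums against this law, in
    place of integrals over [Omega]. *)
Definition path_law n (u : n.+1.-tuple S) : R := fine (P [set w | hist n w = u]).

Lemma path_law_ge0 n u : 0 <= path_law n u.
Proof. exact/fine_ge0/measure_ge0. Qed.

Lemma path_lawE n u : P [set w | hist n w = u] = (path_law n u)%:E.
Proof. by rewrite fineK// fin_num_measure//; exact: measurable_history. Qed.

Lemma path_law_event n (C : pred (n.+1.-tuple S)) :
  P [set w | C (hist n w)] = (\sum_(u | C u) path_law n u)%:E.
Proof.
rewrite probability_fibers => [|u]; last exact: measurable_history.
by rewrite -sumEFin; apply: eq_bigr => u _; rewrite path_lawE.
Qed.

Lemma path_law_sum n : \sum_u path_law n u = 1.
Proof.
apply: EFin_inj; rewrite -(path_law_event n predT).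
rewrite (_ : mkset _ = setT) ?probability_setT//.
by apply/seteqP; split.
Qed.

Lemma path_lawS n t u :
  path_law n.+1 (cons_tuple t u) = path_law n u * p (thead u) t.
Proof.
have [mZ Zp] := Z_markov.
(* Histories run backwards, so time [k] sits at index [n - k]; only times up to [n] enter the past
   event. *)
pose s k := tnth u (inord (n - k)).
have pastE : [set w | forall k, (k <= n)%N -> Z k w = s k] = [set w | hist n w = u].
  apply/seteqP; split=> w /= hw.
    apply: eq_from_tnth => i; rewrite tnth_mktuple hw ?leq_subr// /s.
    by rewrite subKn ?inord_val// -ltnS.
  move=> k kn; rewrite /s -hw tnth_mktuple inordK ?subKn//.
  by rewrite ltnS leq_subr.
have stepE : [set w | hist n.+1 w = cons_tuple t u]
    = [set w | Z n.+1 w = t] `&` [set w | hist n w = u].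
  apply/seteqP; split=> w /=; rewrite /hist historyS.
    move=> /(congr1 val)/= [zt hu]; split=> //; exact: val_inj.
  by move=> [-> ->].
rewrite /path_law stepE.
(* The Markov property says nothing after a null history; there both sides are 0 by monotonicity of
   [P]. *)
have [P0|P_neq0] := eqVneq (P [set w | hist n w = u]) 0%E.
  rewrite P0 mul0r (@subset_measure0 _ _ _ _ _ [set w | hist n w = u])//.
  - by apply: measurableI; [exact: mZ|exact: measurable_history].
  - exact: measurable_history.
have := Zp n s t; rewrite /= pastE => /(_ P_neq0).
rewrite /s subnn (_ : inord 0 = ord0) -/(thead u); last first.
  by apply: val_inj; rewrite /= inordK.
move=> <-; rewrite /cond_prob mulrC divfK//.
by rewrite -eqe fineK// fin_num_measure//; exact: measurable_history.
Qed.

(** Tower property: average first over the last step given the past, then over the past. *)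
Lemma path_law_mean_recl n (F : n.+2.-tuple S -> R) :
  \sum_u path_law n.+1 u * F u =
  \sum_v path_law n v * \sum_t p (thead v) t * F (cons_tuple t v).
Proof.
rewrite tuple_recl_sum; apply: eq_bigr => v _.
by rewrite mulr_sumr; apply: eq_bigr => t _; rewrite path_lawS mulrA.
Qed.

End PathLaw.

(** * Moments of additive functionals with centered increments *)

(** The head is the latest state, so a leading pair [t :: s] stands for the step from [s] to [t]; a
    path with a single state has sum 0. *)
Fixpoint path_sum {R : realType} {S : finType} (D : S -> S -> R) (u : seq S) : R :=
  if u is t :: ((s :: _) as v) then path_sum D v + D s t else 0.

Lemma path_sum_cons (R : realType) (S : finType) (D : S -> S -> R) (n : nat)
    (t : S) (u : n.+1.-tuple S) :
  path_sum D (cons_tuple t u) = path_sum D u + D (thead u) t.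
Proof. by case/tupleP: u. Qed.

Lemma path_sum_history (R : realType) (S : finType) (D : S -> S -> R)
    (z : nat -> S) (n : nat) :
  path_sum D (history S z n) = \sum_(0 <= k < n) D (z k) (z k.+1).
Proof.
elim: n => [|n IHn]; first by
  rewrite big_geq//; case/tupleP: (history S z 0) => s u; rewrite (tuple0 u).
rewrite historyS path_sum_cons IHn big_nat_recr//=; congr (_ + D _ _).
by rewrite /thead tnth_mktuple subn0.
Qed.

(** As in the quartic bound below, the increment [x] survives only linearly, the form in which
    centering removes it. *)
Lemma sqr_step_le (R : realDomainType) (a x c : R) :
  x ^+ 2 <= c -> (a + x) ^+ 2 <= a ^+ 2 + 2 * a * x + c.
Proof. by move=> xc; nra. Qed.

Lemma pow4_step_le (R : realDomainType) (a x c : R) :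
  x ^+ 2 <= c ->
  (a + x) ^+ 4 <= a ^+ 4 + 4 * a ^+ 3 * x + 8 * c * a ^+ 2 + 3 * c ^+ 2.
Proof.
move=> xc; have c_ge0 : 0 <= c := le_trans (sqr_ge0 x) xc.
(* [4 a x^3 <= 2 a^2 x^2 + 2 x^4] *)
have amgm : 0 <= 2 * (x * (a - x)) ^+ 2 by rewrite mulr_ge0// sqr_ge0.
have xa : 8 * (a ^+ 2 * x ^+ 2) <= 8 * (a ^+ 2 * c).
  by rewrite ler_wpM2l// ler_wpM2l// sqr_ge0.
have x4 : (x ^+ 2) ^+ 2 <= c ^+ 2 by rewrite lerXn2r// nnegrE sqr_ge0.
(* Absorbing [4 a x^3] by the inequality [amgm] raises the binomial coefficients 6 and 1 of
   [a^2 x^2] and [x^4] to 8 and 3. *)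
have -> : (a + x) ^+ 4 = a ^+ 4 + 4 * a ^+ 3 * x + 8 * (a ^+ 2 * x ^+ 2)
    + 3 * (x ^+ 2) ^+ 2 - 2 * (x * (a - x)) ^+ 2 by ring.
lra.
Qed.

Section MartingaleMoments.
Context {R : realType} {d : measure_display} {Omega : measurableType d}.
Context {P : probability Omega R} {S : finType} {p : S -> S -> R}.
Context {Z : nat -> Omega -> S} {D : S -> S -> R} {c : R}.
Hypothesis c_ge0 : 0 <= c.
Hypothesis p_sto : stochastic p.
Hypothesis Z_markov : markov_chain P p Z.
Hypothesis D_centered : forall s, \sum_t p s t * D s t = 0.
Hypothesis D_bounded : forall s t, D s t ^+ 2 <= c.

Let mean n (F : n.+1.-tuple S -> R) := \sum_u path_law (P := P) (Z := Z) n u * F u.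

Let mean_cst n a : mean n (fun=> a) = a.
Proof. by rewrite /mean -mulr_suml (path_law_sum Z_markov) mul1r. Qed.

(* The term linear in the increment has mean zero given the past. *)
Let mean_step n (F : R -> R) (F1 F0 : R -> R) :
  (forall a x, x ^+ 2 <= c -> F (a + x) <= F0 a + F1 a * x) ->
  mean n.+1 (F \o path_sum D) <= mean n (F0 \o path_sum D).
Proof.
move=> F_le; rewrite /mean (path_law_mean_recl Z_markov).
apply: ler_sum => v _; rewrite ler_wpM2l ?path_law_ge0//.
have [p_ge0 p_sum1] := p_sto; set a := path_sum D v.
apply: (@le_trans _ _ (\sum_t p (thead v) t * (F0 a + F1 a * D (thead v) t))).
  apply: ler_sum => t _; rewrite ler_wpM2l//.
  by rewrite /comp path_sum_cons F_le.
under eq_bigr do rewrite mulrDr mulrCA.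
by rewrite big_split/= -mulr_suml p_sum1 mul1r -mulr_sumr D_centered mulr0 addr0.
Qed.

Let mean_path_sum0 k : mean 0 (fun u => path_sum D u ^+ k.+1) = 0.
Proof.
rewrite /mean big1// => u _.
by case/tupleP: u => s u; rewrite (tuple0 u)/= expr0n mulr0.
Qed.

Lemma second_moment_le n : mean n (fun u => path_sum D u ^+ 2) <= n%:R * c.
Proof.
elim: n => [|n IHn]; first by rewrite mean_path_sum0 mul0r.
apply: le_trans (mean_step n (fun a => a ^+ 2) (fun a => 2 * a)
  (fun a => a ^+ 2 + c) _) _.
  by move=> a x /sqr_step_le-/(_ a); lra.
rewrite /mean/=; under eq_bigr do rewrite mulrDr.
rewrite big_split/= -[X in _ + X]/(mean n (fun=> c)) mean_cst.
by rewrite -natr1 mulrDl mul1r lerD2r.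
Qed.

(** By the second moment bound, one step adds at most [8 c (n c) + 3 c^2], and
    [4 n^2 + 8 n + 3 <= 4 (n + 1)^2]. *)
Lemma fourth_moment_le n :
  mean n (fun u => path_sum D u ^+ 4) <= 4 * n%:R ^+ 2 * c ^+ 2.
Proof.
elim: n => [|n IHn]; first by rewrite mean_path_sum0 expr0n mulr0 mul0r.
apply: le_trans (mean_step n (fun a => a ^+ 4) (fun a => 4 * a ^+ 3)
  (fun a => a ^+ 4 + (8 * c * a ^+ 2 + 3 * c ^+ 2)) _) _.
  by move=> a x /pow4_step_le-/(_ a); lra.
have -> : mean n ((fun a => a ^+ 4 + (8 * c * a ^+ 2 + 3 * c ^+ 2)) \o path_sum D)
    = mean n (fun u => path_sum D u ^+ 4)
      + (8 * c * mean n (fun u => path_sum D u ^+ 2) + 3 * c ^+ 2).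
  rewrite -[X in _ + (_ + X)](mean_cst n) /mean mulr_sumr -!big_split/=.
  by apply: eq_bigr => u _; ring.
have := ler_wpM2l (mulr_ge0 (ler0n R 8) c_ge0) (second_moment_le n).
have := sqr_ge0 c; rewrite -natr1; lra.
Qed.

End MartingaleMoments.

(** * Borel-Cantelli and the strong law for the martingale *)

Lemma sum_inv_sqr_le (R : realFieldType) (n : nat) :
  \sum_(0 <= k < n) (k.+1%:R ^+ 2)^-1 <= 2 :> R.
Proof.
(* The sharper bound makes the induction telescope, since [1 / k^2 <= 2 / (k (k + 1)) = 2 / k - 2 /
   (k + 1)]. *)
suff : \sum_(0 <= k < n) (k.+1%:R ^+ 2)^-1 <= 2 - 2 / n.+1%:R :> R.
  by move/le_trans; apply; rewrite gerBl divr_ge0.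
elim: n => [|n IHn]; first by rewrite big_geq// divr1 subrr.
rewrite big_nat_recr//=; apply: le_trans (lerD IHn (lexx _)) _.
have n_gt0 : 0 < n.+1%:R :> R by rewrite ltr0n.
have n2_gt0 : 0 < n.+2%:R :> R by rewrite ltr0n.
suff : (n.+1%:R ^+ 2)^-1 <= 2 / n.+1%:R - 2 / n.+2%:R :> R.
  by move=> h; rewrite -addrA lerD2l addrC -lerBrDr opprK addrC.
have -> : 2 / n.+1%:R - 2 / n.+2%:R = 2 / (n.+1%:R * n.+2%:R) :> R.
  rewrite -(natr1 n.+1) in n2_gt0 *; field.
  by rewrite !gt_eqF.
rewrite -div1r ler_pdivrMr ?exprn_gt0// mulrAC ler_pdivlMr ?mulr_gt0//.
have : 1 <= n.+1%:R :> R by rewrite ler1n.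
by rewrite -(natr1 n.+1) mul1r; nra.
Qed.

Lemma borel_cantelli_inv_sqr (R : realType) (d : measure_display)
    (Omega : measurableType d) (P : probability Omega R)
    (F : nat -> set Omega) (C : R) :
  (forall n, measurable (F n)) ->
  (forall n, (P (F n) <= (C / n.+1%:R ^+ 2)%:E)%E) -> 0 <= C ->
  {ae P, forall w, \forall n \near \oo, ~ F n w}.
Proof.
move=> mF PF C_ge0.
exists (lim_sup_set F); split.
- apply: bigcap_measurable => // n _.
  by apply: bigcup_measurable => k _; exact: mF.
(* The exceptional set is the limsup of the events; it is null because their probabilities sum to at
   most [2 C]. *)
- apply: lim_sup_set_cvg0 => //; apply: (@le_lt_trans _ _ (C * 2)%:E).
    apply: lime_le; first by apply: is_cvg_nneseries => n _ _; exact: measure_ge0.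
    apply: nearW => n.
    apply: (@le_trans _ _ (\sum_(0 <= k < n) (C / k.+1%:R ^+ 2)%:E)%E).
      by apply: lee_sum => k _; exact: PF.
    by rewrite sumEFin lee_fin -mulr_sumr ler_wpM2l// sum_inv_sqr_le.
  exact: ltry.
- move=> w /= notev n _; apply: contrapT => notF; apply: notev.
  by exists n => // k /= nk Fk; apply: notF; exists k.
Qed.

Lemma martingale_slln (R : realType) (d : measure_display)
    (Omega : measurableType d) (P : probability Omega R) (S : finType)
    (p : S -> S -> R) (Z : nat -> Omega -> S) (D : S -> S -> R) :
  stochastic p -> markov_chain P p Z ->
  (forall s, \sum_t p s t * D s t = 0) ->
  {ae P, forall w, (fun n => n.+1%:R^-1 *
     \sum_(0 <= k < n.+1) D (Z k w) (Z k.+1 w)) @ \oo --> (0 : R)}.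
Proof.
move=> p_sto Z_markov D_centered.
pose c := \sum_s \sum_t D s t ^+ 2.
have c_ge0 : 0 <= c.
  by apply: sumr_ge0 => s _; apply: sumr_ge0 => t _; exact: sqr_ge0.
have D_bounded s t : D s t ^+ 2 <= c.
  rewrite /c (bigD1 s)//= (bigD1 t)//= -addrA lerDl addr_ge0//.
    by apply: sumr_ge0 => ? _; exact: sqr_ge0.
  by apply: sumr_ge0 => ? _; apply: sumr_ge0 => ? _; exact: sqr_ge0.
pose M n w := \sum_(0 <= k < n.+1) D (Z k w) (Z k.+1 w).
(* The [n.+1] increments of the average at index [n] need a path of [n.+2] states. *)
pose big eps n (u : n.+2.-tuple S) := eps * n.+1%:R < `|path_sum D u|.
pose F eps n := [set w | big eps n (history S (Z ^~ w) n.+1)].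
have PF eps n : 0 < eps ->
    (P (F eps n) <= (4 * c ^+ 2 / eps ^+ 4 / n.+1%:R ^+ 2)%:E)%E.
  move=> eps_gt0; rewrite (path_law_event Z_markov) lee_fin.
  have := fourth_moment_le c_ge0 p_sto Z_markov D_centered D_bounded n.+1.
  set x := eps * n.+1%:R; have x_gt0 : 0 < x by rewrite mulr_gt0// ltr0n.
  (* The bound is the fourth moment estimate at [n.+1] divided by the fourth power of the threshold
     [x], as Markov's inequality requires; it decays like [1 / n^2]. *)
  have -> : 4 * c ^+ 2 / eps ^+ 4 / n.+1%:R ^+ 2 =
      4 * n.+1%:R ^+ 2 * c ^+ 2 / x ^+ 4.
    have n_gt0 : 0 < n.+1%:R :> R by rewrite ltr0n.
    by rewrite /x; field; rewrite !gt_eqF.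
  move=> m4; rewrite ler_pdivlMr ?exprn_gt0//; apply: le_trans m4.
  rewrite mulr_suml [leRHS](bigID (big eps n))/= -[leLHS]addr0 lerD//.
    apply: ler_sum => u; rewrite /big -/x => ux.
    rewrite ler_wpM2l ?path_law_ge0// -[leRHS]ger0_norm ?exprn_even_ge0//.
    by rewrite normrX lerXn2r// ?nnegrE ltW.
  by apply: sumr_ge0 => u _; rewrite mulr_ge0 ?path_law_ge0// exprn_even_ge0.
have mF eps n : measurable (F eps n).
  rewrite (_ : F eps n = \bigcup_(u in [set u | big eps n u])
      [set w | history S (Z ^~ w) n.+1 = u]).
    by apply: fin_bigcup_measurable => // u _; exact: (measurable_history Z_markov).
  apply/seteqP; split=> [w Fw|w [u /= bu hu]].
    by exists (history S (Z ^~ w) n.+1).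
  by rewrite /F/= hu.
(* Countably many thresholds [1 / (j + 1)] suffice, so the almost sure events can be intersected
   before [eps] is chosen. *)
have ev (j : nat) : {ae P, forall w, \forall n \near \oo, ~ F j.+1%:R^-1 n w}.
  apply: (borel_cantelli_inv_sqr _ _ _ P _ _ (mF _)) => [n|].
    by apply: PF; rewrite invr_gt0 ltr0n.
  by rewrite divr_ge0 ?exprn_even_ge0// mulr_ge0// sqr_ge0.
apply: filterS (ae_foralln ev) => w evw.
apply/cvgr0Pnorm_le => eps eps_gt0.
have [j jeps] : exists j : nat, j.+1%:R^-1 <= eps.
  exists (Num.truncn eps^-1); rewrite -[leRHS]invrK.
  by rewrite lef_pV2 ?posrE ?invr_gt0 ?ltr0n// ltW// truncnS_gt.
apply: filterS (evw j) => n /negP; rewrite /big -leNgt path_sum_history => Mn.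
have n_gt0 : 0 < n.+1%:R :> R by rewrite ltr0n.
rewrite normrM normfV (gtr0_norm n_gt0) mulrC ler_pdivrMr//; apply: le_trans Mn _.
by rewrite ler_wpM2r// ltW.
Qed.

Lemma bounded_average_cvg0 (R : realType) (u : nat -> R) (B : R) :
  (forall n, `|u n| <= B) -> (fun n => n.+1%:R^-1 * u n) @ \oo --> (0 : R).
Proof.
move=> uB; have hB : (fun n => n.+1%:R^-1 * B) @ \oo --> (0 : R).
  by rewrite -(mul0r B); apply: cvgMl; exact: cvg_harmonic.
apply/norm_cvg0P; apply: (squeeze_cvgr _ (cvg_cst 0) hB).
apply: nearW => n; rewrite normr_ge0 normrM ger0_norm ?invr_ge0//=.
by rewrite ler_wpM2l// invr_ge0.
Qed.

(** * Ergodic averages of the walk *)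

Lemma locally_markov_walk_average (R : realType) (V : finType) (e : rel V)
    (m : forall x : V, nbr e x -> nbr e x -> R)
    (d : measure_display) (Omega : measurableType d) (P : probability Omega R)
    (X : nat -> Omega -> V) (q : forall x : V, nbr e x -> R) (pi f : V -> R) :
  strongly_connected e ->
  (forall x, stochastic (m x)) -> (forall x y z, 0 < m x y z) ->
  (forall x, stationary_distribution (m x) (q x)) ->
  stationary_distribution (extend_by_zero q) pi ->
  locally_markov_walk P m X ->
  {ae P, forall w, (fun n => n.+1%:R^-1 * \sum_(0 <= k < n.+1) f (X k w)) @ \oo
     --> \sum_x f x * pi x}.
Proof.
move=> e_conn m_sto m_gt0 q_stat pi_stat [rho [_ Z_markov]].
pose p := total_transition m.
have p_sto : stochastic p := total_transition_stochastic _ _ _ _ m_sto.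
have [g gE] := total_poisson_equation _ _ _ _ _ _ f
  e_conn m_sto m_gt0 q_stat pi_stat.
pose Z n w := (X n w, rho n w).
(* Martingale increment: the value of [g] after the step minus its conditional expectation given the
   current state. *)
pose D s t := g t - \sum_j p s j * g j.
have D_centered s : \sum_t p s t * D s t = 0.
  under eq_bigr do rewrite mulrBr.
  by rewrite sumrB -mulr_suml; have [_ ->] := p_sto; rewrite mul1r subrr.
apply: filterS (martingale_slln _ _ _ _ _ _ _ _ p_sto Z_markov D_centered) => w Mw.
have -> : \sum_x f x * pi x = \sum_x pi x * f x.
  by apply: eq_bigr => x _; rewrite mulrC.
set pif := \sum_x _.
have DE s t : D s t = g t - g s + (f s.1 - pif).
  by rewrite /D -gE addrA subrK.
(* Summing [DE] telescopes [g]: the average of [f] is a martingale average, plus a bounded term over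
   [n + 1], plus the limit [pif]. *)
have avgE n : n.+1%:R^-1 * \sum_(0 <= k < n.+1) f (X k w) =
    n.+1%:R^-1 * \sum_(0 <= k < n.+1) D (Z k w) (Z k.+1 w)
    + n.+1%:R^-1 * (g (Z 0%N w) - g (Z n.+1 w)) + pif.
  under [in RHS]eq_bigr do rewrite DE.
  rewrite big_split/= telescope_sumr// sumrB/= sumr_const_nat subn0.
  by field; rewrite nat1r pnatr_eq0.
have g_le s : `|g s| <= \sum_s `|g s|.
  by rewrite [leRHS](bigD1 s)//= lerDl sumr_ge0.
have bnd : (fun n => n.+1%:R^-1 * (g (Z 0%N w) - g (Z n.+1 w))) @ \oo --> (0 : R).
  apply: (bounded_average_cvg0 _ _ (\sum_s `|g s| + \sum_s `|g s|)) => n.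
  by apply: le_trans (ler_normB _ _) _; rewrite lerD.
rewrite (_ : pif = 0 + 0 + pif); last by rewrite !add0r.
rewrite (funext avgE).
by apply: cvgD; [exact: cvgD Mw bnd|exact: cvg_cst].
Qed.

Theorem proposition3p6 (R : realType) (V : finType) (e : rel V)
  (e_irr : irreflexive e) (e_conn : strongly_connected e) (V_ge2 : (2 <= #|V|)%N)
  (m : forall x : V, nbr e x -> nbr e x -> R)
  (m_stoch : forall x : V, stochastic (m x))
  (m_pos : forall (x : V) (y z : nbr e x), 0 < m x y z)
  (d : measure_display) (Omega : measurableType d) (P : probability Omega R)
  (X : nat -> Omega -> V) (X_lmw : locally_markov_walk P m X)
  (q : forall x : V, nbr e x -> R)
  (q_stat : forall x : V, stationary_distribution (m x) (q x))
  (pi : V -> R) (pi_stat : stationary_distribution (extend_by_zero q) pi) :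
  (forall f : V -> R,
     {ae P, forall w,
        (fun t : nat => t%:R^-1 * \sum_(0 <= n < t.+1) f (X n w)) @ \oo
          --> \sum_(x : V) f x * pi x}) /\
  (forall x : V,
     {ae P, forall w,
        (fun t : nat => #|[set n : 'I_t.+1 | X n w == x]%SET|%:R / t.+1%:R : R)
          @ \oo --> pi x}).
Proof.
have avg f := locally_markov_walk_average _ _ _ _ _ _ _ _ _ _ f
  e_conn m_stoch m_pos q_stat pi_stat X_lmw.
split=> [f|x].
  apply: filterS (avg f) => w fw.
  (* The statement divides [t + 1] terms by [t]. Shifting by one avoids [t = 0], where the inverse
     is 0 by convention, and leaves the correction factor [(t + 2) / (t + 1) = 1 + 1 / (t + 1)],
     which tends to 1. *)
  have fwS : (fun t => t.+2%:R^-1 * \sum_(0 <= n < t.+2) f (X n w)) @ \oo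
      --> \sum_x f x * pi x by move: fw; rewrite -(cvg_shiftS _ _).
  rewrite -(cvg_shiftS _ _).
  have -> : \sum_x f x * pi x = (1 + 0) * \sum_x f x * pi x.
    by rewrite addr0 mul1r.
  have -> : (fun t => t.+1%:R^-1 * \sum_(0 <= n < t.+2) f (X n w)) =
      (fun t => (1 + harmonic t) * (t.+2%:R^-1 * \sum_(0 <= n < t.+2) f (X n w))).
    apply/funext => t; rewrite mulrA; congr (_ * _) => /=.
    have t1 : t.+1%:R != 0 :> R by rewrite pnatr_eq0.
    have t2 : t.+2%:R != 0 :> R by rewrite pnatr_eq0.
    rewrite -[X in X + _](divff t1) -[X in _ + X]mul1r.
    by rewrite -mulrDl natr1 mulrAC divff ?mul1r.
  by apply: cvgM fwS; apply: cvgD; [exact: cvg_cst|exact: cvg_harmonic].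
(* For the indicator of [x] the normalisation [t + 1] already agrees with the proportion of
   visits. *)
apply: filterS (avg (fun y => (y == x)%:R)) => w.
have -> : \sum_y (y == x)%:R * pi y = pi x.
  rewrite (bigD1 x)//= eqxx mul1r big1 ?addr0// => y /negPf ->.
  by rewrite mul0r.
move=> h.
apply: (cvg_trans _ h); apply: near_eq_cvg; apply: nearW => t.
rewrite mulrC big_mkord -natr_sum; congr (_%:R / _).
by rewrite -sum1_card [RHS]big_mkcond; apply: eq_bigr => n _; rewrite inE; case: eqP.
Qed.
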